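(* Let $\boldsymbol{\xi}=[\xi_1,\ldots,\xi_d]$ be a random vector in $\mathbb{R}^d$ with joint probability density function $\rho(\boldsymbol{\xi})$. Assume that either $\boldsymbol{\xi}$ is defined on a compact bounded domain, or there exists a constant $a>0$ such that $\mathbb{E}[\exp(a|\xi_i|)]<\infty$ for $i=1,\ldots,d$. Then: (i) the multivariate polynomials in $\xi_1,\ldots,\xi_d$ are dense in $L^2(\boldsymbol{\xi},\rho(\boldsymbol{\xi}))$; (ii) for any $y(\boldsymbol{\xi})\in L^2(\boldsymbol{\xi},\rho(\boldsymbol{\xi}))$ there exist order-$p$ approximations $y_p(\boldsymbol{\xi})=\sum_{|\boldsymbol{\alpha}|=0}^{p}c_{\boldsymbol{\alpha}}\Psi_{\boldsymbol{\alpha}}(\boldsymbol{\xi})$ (one for each $p$, with real coefficients $c_{\boldsymbol{\alpha}}$) such that $\mathbb{E}[(y(\boldsymbol{\xi})-y_p(\boldsymbol{\xi}))^2]\to 0$ as $p\to\infty$.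
   Context: The components of $\boldsymbol{\xi}$ may be correlated and non-Gaussian. $L^2(\boldsymbol{\xi},\rho(\boldsymbol{\xi}))=\{y(\boldsymbol{\xi}):\mathbb{E}[y^2(\boldsymbol{\xi})]<\infty\}$ is the space of square-integrable functions, with expectation taken with respect to $\rho$. For a multi-index $\boldsymbol{\alpha}\in\mathbb{N}^d$, $|\boldsymbol{\alpha}|=\alpha_1+\cdots+\alpha_d$; the sum $\sum_{|\boldsymbol{\alpha}|=0}^{p}$ runs over all multi-indices with $|\boldsymbol{\alpha}|\le p$. Basis functions: for an order $p$, let $\mathbf{b}(\boldsymbol{\xi})$ be the vector of all $n=\binom{d+p}{d}$ monomials $\boldsymbol{\xi}^{\boldsymbol{\alpha}}=\xi_1^{\alpha_1}\cdots\xi_d^{\alpha_d}$ with $|\boldsymbol{\alpha}|\le p$, in graded lexicographic order; let $\mathbf{M}=\mathbb{E}[\mathbf{b}(\boldsymbol{\xi})\mathbf{b}(\boldsymbol{\xi})^T]$, which is positive definite, with Cholesky factorization $\mathbf{M}=\mathbf{L}\mathbf{L}^T$, $\mathbf{L}$ lower triangular. The functions $\Psi_{\boldsymbol{\alpha}}$, $|\boldsymbol{\alpha}|\le p$, are the components of $\boldsymbol{\Psi}(\boldsymbol{\xi})=\mathbf{L}^{-1}\mathbf{b}(\boldsymbol{\xi})$, indexed in graded lexicographic order. *)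

(* Defs.v *)
From HB Require Import structures.
From mathcomp Require Import all_boot all_order all_algebra.
(* mpoly also has a structure named measure, which the later import shadows. *)
From mathcomp Require Import -(notations) mpoly.
From mathcomp Require Import all_classical all_reals all_analysis.

Set Implicit Arguments.
Unset Strict Implicit.
Unset Printing Implicit Defensive.

Import Order.TTheory GRing.Theory Num.Theory numFieldNormedType.Exports.

Local Open Scope classical_set_scope.
Local Open Scope ring_scope.

(* R^d with the product of the Borel sigma-algebras of its coordinates. *)
Notation Rvec R d := (d.-tuple (measurableTypeR R)).

Section lebesgue_step.
Context (R : realType) (d : nat).
Variable mu : {sigma_finite_measure set (Rvec R d) -> \bar R}.
Local Open Scope ereal_scope.

Let RR := measurableTypeR R.

Definition consT (x : RR * Rvec R d) : Rvec R d.+1 := [tuple of x.1 :: x.2].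

Lemma measurable_consT : measurable_fun [set: RR * Rvec R d] consT.
Proof. exact: measurable_cons. Qed.

Definition lebesgue_step : set (Rvec R d.+1) -> \bar R :=
  pushforward (@lebesgue_measure R \x mu) consT.

Let step0 : lebesgue_step set0 = 0.
Proof. by rewrite /lebesgue_step /pushforward preimage_set0 measure0. Qed.

Let step_ge0 A : 0 <= lebesgue_step A.
Proof. by rewrite /lebesgue_step /pushforward; exact: measure_ge0. Qed.

Let step_sigma_additive : semi_sigma_additive lebesgue_step.
Proof.
pose mc := measurable_consT.
move=> F mF tF mUF; rewrite /lebesgue_step /pushforward preimage_bigcup.
apply: measure_semi_sigma_additive.
- by move=> n; rewrite -[X in measurable X]setTI; exact: mc.
- apply/trivIsetP => /= i j _ _ ij; rewrite -preimage_setI.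
  by move/trivIsetP : tF => /(_ _ _ _ _ ij) ->//; rewrite preimage_set0.
- by rewrite -preimage_bigcup -[X in measurable X]setTI; exact: mc.
Qed.

HB.instance Definition _ := isMeasure.Build _ _ _ lebesgue_step
  step0 step_ge0 step_sigma_additive.

Let step_sigma_finite : sigma_finite [set: Rvec R d.+1] lebesgue_step.
Proof.
have /sigma_finiteP[F [TF ndF Foo]] := sigma_finiteT (@lebesgue_measure R).
have /sigma_finiteP[G [TG ndG Goo]] := sigma_finiteT mu.
pose H n := F n `*` G n.
have TH : \bigcup_n H n = setT.
  rewrite -setXTT TF TG predeqE => -[x y]; split.
    by move=> [n _ []/= ? ?]; split; exists n.
  move=> [/= [n _ Fnx] [k _ Gky]]; exists (maxn n k) => //; split.
  - by move: x Fnx; exact/subsetPset/ndF/leq_maxl.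
  - by move: y Gky; exact/subsetPset/ndG/leq_maxr.
pose g (v : Rvec R d.+1) : RR * Rvec R d := (thead v, [tuple of behead v]).
have gK v : consT (g v) = v by rewrite /consT /g /= -tuple_eta.
have Kg x : g (consT x) = x.
  by case: x => a t; congr pair; apply/val_inj.
have mg : measurable_fun [set: Rvec R d.+1] g.
  apply/measurable_fun_pair; first exact: measurable_tnth.
  exact: measurable_behead.
exists (fun n => g @^-1` H n).
  by rewrite -preimage_bigcup TH preimage_setT.
move=> n; have [? ?] := Foo n; have [? ?] := Goo n.
have mH : measurable (H n) by exact: measurableX.
split; first by rewrite -[X in measurable X]setTI; exact: mg.
rewrite /lebesgue_step /pushforward.
rewrite (_ : consT @^-1` (g @^-1` H n) = H n)//; last first.
  by apply/seteqP; split => x /=; rewrite Kg.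
by rewrite product_measure1E// lte_mul_pinfty// ge0_fin_numE.
Qed.

HB.instance Definition _ := Measure_isSigmaFinite.Build _ _ _ lebesgue_step
  step_sigma_finite.

End lebesgue_step.

(* d-dimensional Lebesgue measure: R^0 carries the unit point mass and
   R^(d+1) = R * R^d the product measure; see lebesgueE_box. *)
Fixpoint lebesgue (R : realType) (d : nat) :
    {sigma_finite_measure set (Rvec R d) -> \bar R} :=
  if d is d'.+1 then lebesgue_step (lebesgue R d')
  else \d_([tuple] : Rvec R 0).

Lemma measurable_box (R : realType) (d : nat)
    (A : 'I_d -> set (measurableTypeR R)) :
  (forall i, measurable (A i)) ->
  measurable [set x : Rvec R d | forall i, A i (tnth x i)].
Proof.
move=> mA.
rewrite (_ : [set _ | _] =
    \bigcap_(i in [set: 'I_d]) (fun x : Rvec R d => tnth x i) @^-1` A i).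
  apply: fin_bigcap_measurable => [|i _]; first exact: finite_finset.
  by rewrite -[X in measurable X]setTI; exact: measurable_tnth.
by apply/seteqP; split=> x /= Ax i => [_|]; [exact: Ax | exact: (Ax i I)].
Qed.

Lemma lebesgueE_box (R : realType) (d : nat)
    (A : 'I_d -> set (measurableTypeR R)) :
  (forall i, measurable (A i)) ->
  lebesgue R d [set x | forall i, A i (tnth x i)] =
  (\prod_(i < d) lebesgue_measure (A i))%E.
Proof.
elim: d A => [A _|d IH A mA].
  by rewrite big_ord0 /= diracE mem_set// => -[].
rewrite big_ord_recl -IH => [|i]; last exact: mA.
rewrite /= {1}/lebesgue_step /pushforward -product_measure1E//; last first.
  by apply: (@measurable_box _ _ (fun i => A (lift ord0 i))) => i; exact: mA.
congr (_ _); apply/seteqP; split => -[a t] /=.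
  move=> At; split; first exact: (At ord0).
  by move=> i; have := At (lift ord0 i); rewrite tnthS.
move=> [A0 At] i; case: (unliftP ord0 i) => [j ->|->]; last by [].
by rewrite tnthS; exact: At.
Qed.

(* The multi-indices of degree at most p, increasing for graded lexicographic
   order: a < b iff |a| < |b|, or |a| = |b| and the first j with a j != b j has
   a j < b j. This is mnmc_le, cf. lt_mdeg_ltmc and ltmcP (the header of mpoly
   calls it degrevlex). *)
Definition grlex (d p : nat) : seq (multinom d) :=
  sort (@mnmc_le d) [seq bmnm a | a <- enum {: bmultinom d p.+1}].

Lemma mem_grlex d p (a : multinom d) : (a \in grlex d p) = (mdeg a <= p)%N.
Proof.
rewrite mem_sort; apply/mapP/idP => [[b _ ->]|ap]; first by rewrite -ltnS bmdeg.
by exists (BMultinom (ap : (mdeg a < p.+1)%N)); rewrite ?mem_enum.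
Qed.

Lemma grlex_uniq d p : uniq (grlex d p).
Proof. by rewrite sort_uniq map_inj_uniq ?enum_uniq//; exact: val_inj. Qed.

Lemma size_grlex d p : size (grlex d p) = 'C(d + p, d).
Proof.
rewrite -card_partial_ord_partitions size_sort cardE.
pose f (t : d.-tuple 'I_p.+1) : multinom d := Multinom (map_tuple val t).
have fE t : mdeg (f t) = (\sum_(i <- t) i)%N.
  by rewrite mdegE big_tuple; apply: eq_bigr => i _; rewrite multinomE tnth_map.
have finj : injective f.
  move=> s t /(congr1 val) /(congr1 val) /= /(inj_map val_inj) st.
  exact/val_inj.
rewrite -(size_map f); apply/perm_size/uniq_perm.
- by rewrite map_inj_uniq ?enum_uniq//; exact: val_inj.
- by rewrite map_inj_uniq ?enum_uniq.
move=> a; have := mem_grlex p a; rewrite mem_sort => ->.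
apply/idP/mapP => [ap|[t]]; last by rewrite mem_enum inE -fE => ? ->.
have ai j : (a j <= p)%N.
  by rewrite (leq_trans _ ap)// mdegE (bigD1 j)//= leq_addr.
pose t := [tuple inord (a j) : 'I_p.+1 | j < d].
have aE : a = f t.
  by apply/mnmP => j; rewrite multinomE tnth_map tnth_mktuple /= inordK// ltnS.
by exists t => //; rewrite mem_enum inE -fE -aE.
Qed.

Section chaos.
Context (R : realType) (disp : measure_display) (T : measurableType disp).
Context (P : probability T R) (d : nat) (X : {RV P >-> Rvec R d}).

Definition joint_density (rho : Rvec R d -> R) :=
  [/\ measurable_fun setT rho, (forall x, 0 <= rho x) &
      forall A, measurable A ->
        P (X @^-1` A) = (\int[lebesgue R d]_(x in A) (rho x)%:E)%E].

Definition compact_range :=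
  exists2 K : set 'rV[R]_d, compact K &
    {ae P, forall w, K (\row_j tnth (X w) j)}.

Definition exp_moments :=
  exists2 a : R, 0 < a &
    forall i, ('E_P[fun w => expR (a * `|(tnth (X w) i : R)|)] < +oo)%E.

Definition L2 (y : Rvec R d -> R) :=
  measurable_fun setT y /\ ('E_P[fun w => (y (X w) ^+ 2)%R] < +oo)%E.

Definition sqdist (y z : Rvec R d -> R) : \bar R :=
  ('E_P[fun w => ((y (X w) - z (X w)) ^+ 2)%R])%E.

(* Inclusion in L2 is part of the notion: the elements of D have to be
   points of the space in which D is dense. *)
Definition L2_dense (D : set (Rvec R d -> R)) :=
  D `<=` L2 /\
  forall y, L2 y -> forall e : R, 0 < e ->
    exists2 z, D z & (sqdist y z < (e ^+ 2)%:E)%E.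

Definition polynomials : set (Rvec R d -> R) :=
  range (fun (q : mpoly d R) (x : Rvec R d) => meval (tnth x) q).

Definition monomials (p : nat) (x : Rvec R d) : 'cV[R]_('C(d + p, d)) :=
  \col_i \prod_(j < d) (tnth x j : R) ^+ (nth (@mnm0 d) (grlex d p) i) j.

Definition moment_mx (p : nat) : 'M[R]_('C(d + p, d)) :=
  \matrix_(i, j)
    fine ('E_P[fun w => ((monomials p (X w) *m (monomials p (X w))^T) i j)%R])%E.

(* The diagonal of L is not required to be positive, nor is M assumed to be
   invertible. *)
Definition cholesky n (M L : 'M[R]_n) := is_trig_mx L /\ M = L *m L^T.

Definition chaos_basis p (L : 'M[R]_('C(d + p, d))) (x : Rvec R d) :=
  invmx L *m monomials p x.

(* The coefficient and the basis function of the i-th multi-index are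
   indexed by i. *)
Definition chaos_sum p (L : 'M[R]_('C(d + p, d))) (c : 'I_('C(d + p, d)) -> R)
    (x : Rvec R d) : R :=
  \sum_i c i * chaos_basis L x i 0.

End chaos.

(* Main.v *)
(* Write mu for the law of xi; compact support gives exponential moments, and
   these give E exp(b(|xi_1| + ... + |xi_d|)) < oo for some b > 0. Let V be the
   closure of the polynomials in L2(mu) and W the algebra of bounded
   multipliers of V; W is closed under bounded pointwise limits. For small s,
   Taylor expansion and dominated convergence put cos (s x_i) and sin (s x_i)
   in W. If f is in W then so are |f| and the indicator of {f > 0}, so the sets
   whose indicator lies in W form a sigma-algebra; it contains {x_i > c}, the
   limit of {sin ((x_i - c) / n) > 0}, hence all Borel sets. Therefore V
   contains the simple functions, and V = L2(mu).

   The zero set of a nonzero polynomial is Lebesgue-null, so the existence of a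
   density makes the moment matrix invertible and the Psi_alpha, |alpha| <= p,
   span the polynomials of degree at most p. The y_p are then near-best
   approximations of y in these increasing spaces. *)
Require Import Defs.
From mathcomp Require Import all_boot all_order all_algebra.
From mathcomp Require Import -(notations) mpoly.
From mathcomp Require Import all_classical all_reals all_analysis.
From mathcomp Require Import measurable_realfun.
From mathcomp Require Import ring lra.
Import Order.TTheory GRing.Theory Num.Theory numFieldNormedType.Exports.
Local Open Scope classical_set_scope.
Import HBNNSimple.
Local Open Scope ring_scope.

Set Implicit Arguments.
Unset Strict Implicit.
Unset Printing Implicit Defensive.

(** * Bounded multipliers of an L2 closure *)

Section abs_approx.
Context (R : realType).

(* The classical square-root iteration for sqrt (t^2), started at 0. *)
Definition abs_approx (t : R) n : R :=
  iter n (fun p => p + (t ^+ 2 - p ^+ 2) / 2) 0.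

(** For t >= 0 one step p -> p' satisfies t - p' = (t - p) (1 - (t + p) / 2). As 0 <= p <= t <= 1,
    the last factor lies between 0 and 1 - t / 2. *)
Lemma abs_approx_bound (t : R) n : `|t| <= 1 ->
  [/\ 0 <= abs_approx t n, abs_approx t n <= `|t| &
      `|t| - abs_approx t n <= `|t| * (1 - `|t| / 2) ^+ n].
Proof.
rewrite /abs_approx -(real_normK (num_real t)); move: `|t| (normr_ge0 t) => {}t t0 t1.
elim: n => [|n [p0 pt tp]]; first by rewrite /= subr0 expr0 mulr1.
rewrite iterS [_ ^+ n.+1]exprSr mulrA; move: (iter n _ _) p0 pt tp => p p0 pt tp.
have q0 : 0 <= 1 - t / 2 by lra.
split; [nra|nra|apply: (@le_trans _ _ ((t - p) * (1 - t / 2))); last exact: ler_wpM2r].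
nra.
Qed.

Lemma abs_approx_cvg (t : R) : `|t| <= 1 -> abs_approx t n @[n --> \oo] --> `|t|.
Proof.
move=> t1; have [->|t0] := eqVneq t 0.
  rewrite normr0 (_ : abs_approx 0 = cst 0); first exact: cvg_cst.
  apply/funext => n; have := @abs_approx_bound 0 n.
  by rewrite normr0 ler01 => /(_ isT)[? ? _]; apply/eqP; rewrite eq_le; apply/andP.
have tn0 : 0 < `|t| by rewrite normr_gt0.
apply: (@squeeze_cvgr _ _ _ _ (fun n => `|t| - `|t| * (1 - `|t| / 2) ^+ n) (cst `|t|)).
- by apply: nearW => n; have [] := abs_approx_bound n t1; rewrite /cst; lra.
- suff: `|t| - `|t| * (1 - `|t| / 2) ^+ n @[n --> \oo] --> `|t| - `|t| * 0.
    by rewrite mulr0 subr0.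
  apply: cvgB; first exact: cvg_cst.
  apply: cvgMr; apply: cvg_expr; rewrite ger0_norm; lra.
- exact: cvg_cst.
Qed.

Lemma indic_gt0_cvg (t : R) : 0 <= t <= 1 ->
  1 - (1 - t) ^+ n @[n --> \oo] --> ((0 < t)%R%:R : R).
Proof.
move=> /andP[t0 t1]; have [->|tn0] := eqVneq t 0.
  rewrite ltxx; under eq_fun do rewrite subr0 expr1n subrr; exact: cvg_cst.
have tp : 0 < t by rewrite lt_neqAle eq_sym tn0.
rewrite tp -[X in _ --> X](subr0 1); apply: cvgB; first exact: cvg_cst.
by apply: cvg_expr; rewrite ger0_norm; lra.
Qed.

End abs_approx.

(** * Mean-square norm and dominated convergence *)

Section mean_square.
Context (disp : measure_display) (S : measurableType disp) (R : realType).
Context (mu : probability S R).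
Implicit Types (f g h : S -> R) (D : set (S -> R)).

(** The squared L2 norm, on functions rather than classes and with value +oo allowed. Working with
    squares avoids roots; [sqnormD_le], with its factor 2, stands in for the triangle inequality. *)
Definition sqnorm f : \bar R := (\int[mu]_x (f x ^+ 2)%:E)%E.

Lemma ler_sqr_norm (x y : R) : (x ^+ 2 <= y ^+ 2) = (`|x| <= `|y|).
Proof. by rewrite -(real_normK (num_real x)) -(real_normK (num_real y)) ler_sqr. Qed.

Lemma sqnorm_ge0 f : (0 <= sqnorm f)%E.
Proof. by apply: integral_ge0 => x _; rewrite lee_fin sqr_ge0. Qed.

Lemma measurable_sqr f : measurable_fun setT f ->
  measurable_fun setT (fun x => (f x ^+ 2)%:E).
Proof. by move=> mf; apply/measurable_EFinP; exact: measurable_funX. Qed.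

Lemma sqnorm_le f g : measurable_fun setT f -> measurable_fun setT g ->
  (forall x, `|f x| <= `|g x|) -> (sqnorm f <= sqnorm g)%E.
Proof.
move=> mf mg fg; apply: ge0_le_integral => //; try exact: measurable_sqr.
  by move=> x _; rewrite lee_fin sqr_ge0.
by move=> x _; rewrite lee_fin ler_sqr_norm.
Qed.

Lemma sqnormZ (c : R) f : measurable_fun setT f ->
  sqnorm (fun x => c * f x) = ((c ^+ 2)%:E * sqnorm f)%E.
Proof.
move=> mf; rewrite /sqnorm -ge0_integralZl_EFin ?sqr_ge0//.
- by apply: eq_integral => x _; rewrite exprMn EFinM.
- by move=> x _; rewrite lee_fin sqr_ge0.
- exact: measurable_sqr.
Qed.

Lemma sqnormD_le f g : measurable_fun setT f -> measurable_fun setT g ->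
  (sqnorm (fun x => f x + g x)%R <= 2%:E * (sqnorm f + sqnorm g))%E.
Proof.
move=> mf mg; rewrite /sqnorm.
have sq h x : setT x -> (0 <= (h x ^+ 2)%:E)%E by rewrite lee_fin sqr_ge0.
have mD : measurable_fun setT (fun x => f x + g x) by exact: measurable_funD.
rewrite -ge0_integralD//; 
  [|exact: sq|exact: measurable_sqr|exact: sq|exact: measurable_sqr].
rewrite -ge0_integralZl_EFin//; first last.
- by apply: emeasurable_funD; exact: measurable_sqr.
- by move=> x _; rewrite adde_ge0// lee_fin sqr_ge0.
apply: ge0_le_integral => //.
- exact: sq.
- exact: measurable_sqr.
- by apply: measurable_funeM; apply: emeasurable_funD; exact: measurable_sqr.
- move=> x _; rewrite -EFinD -EFinM lee_fin.
  have := sqr_ge0 (f x - g x); nra.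
Qed.

Lemma sqnorm_cst (c : R) : sqnorm (cst c) = (c ^+ 2)%:E.
Proof.
transitivity (\int[mu]_x cst (c ^+ 2)%:E x)%E => //.
by rewrite integral_cst//= probability_setT mule1.
Qed.

Lemma sqnorm_dominated_cvg0 (u : nat -> S -> R) h :
  (forall n, measurable_fun setT (u n)) ->
  (forall x, u n x @[n --> \oo] --> (0 : R)) ->
  measurable_fun setT h -> (sqnorm h < +oo)%E ->
  (forall n x, `|u n x| <= `|h x|) ->
  sqnorm (u n) @[n --> \oo] --> 0%E.
Proof.
move=> mu_ u0 mh hoo uh.
have ih : mu.-integrable setT (fun x => (h x ^+ 2)%:E).
  apply/integrableP; split; first exact: measurable_sqr.
  by under eq_integral do rewrite gee0_abs ?lee_fin ?sqr_ge0//.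
have ul n x : (`|(u n x ^+ 2)%:E| <= (h x ^+ 2)%:E)%E.
  by rewrite gee0_abs lee_fin ?sqr_ge0// ler_sqr_norm.
have u20 x : (u n x ^+ 2)%:E @[n --> \oo] --> 0%E.
  apply: cvg_EFin; first by near=> n.
  rewrite /comp/= -[X in _ --> X](mulr0 (0 : R)); under eq_fun do rewrite expr2.
  exact: cvgM.
have au : \forall x \ae mu, setT x -> (u n x ^+ 2)%:E @[n --> \oo] --> 0%E.
  by apply: aeW => x _; exact: u20.
have al : \forall x \ae mu, forall n, setT x ->
    (`|(u n x ^+ 2)%:E| <= (h x ^+ 2)%:E)%E.
  by apply: aeW => x n _; exact: ul.
have [_ _] := dominated_convergence measurableT (fun n => measurable_sqr (mu_ n))
  (measurable_cst _) au ih al.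
by rewrite integral0.
Unshelve. all: by end_near. Qed.

Lemma cvge0_lt (u : (\bar R)^nat) (e : R) : u n @[n --> \oo] --> 0%E -> 0 < e ->
  \forall n \near \oo, (u n < e%:E)%E.
Proof. by move=> u0 e0; exact: (u0 _ (@nbhs_open_ereal_lt _ 0 (fun=> e) e0)). Qed.

End mean_square.

Lemma cvgn_norm_le (R : realType) (u : R^nat) (l M : R) :
  u n @[n --> \oo] --> l -> (forall n, `|u n| <= M) -> `|l| <= M.
Proof.
move=> ul uM; apply: (ler_cvg_to (cvg_norm ul) (@cvg_cst _ M _ \oo _)).
exact: nearW.
Qed.

(** * The L2 closure of a linear space of functions and its bounded multipliers *)

Section closure.
Context (disp : measure_display) (S : measurableType disp) (R : realType).
Context (mu : probability S R) (D : set (S -> R)).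
Implicit Types (f g h : S -> R).

(** [D] stands for the polynomials: the hypotheses below make it a linear space of square-integrable
    functions containing 1. Note that [e] bounds the squared distance. *)
Definition l2closure f := measurable_fun setT f /\
  forall e : R, 0 < e -> exists2 g, D g & (sqnorm mu (fun x => f x - g x)%R < e%:E)%E.

Context (mD : forall f, D f -> measurable_fun setT f).
Context (ltyD : forall f, D f -> (sqnorm mu f < +oo)%E).
Context (addD : forall f g, D f -> D g -> D (fun x => f x + g x)).
Context (scaleD : forall c f, D f -> D (fun x => c * f x)).
Context (oneD : D (cst 1)).

Lemma sub_l2closure f : D f -> l2closure f.
Proof.
move=> Df; split=> [|e e0]; [exact: mD|exists f => //].
under [X in sqnorm _ X]eq_fun do rewrite subrr.
by have := sqnorm_cst mu 0; rewrite expr0n => ->.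
Qed.

Lemma l2closure_closed f : measurable_fun setT f ->
  (forall e : R, 0 < e ->
     exists2 g, l2closure g & (sqnorm mu (fun x => f x - g x)%R < e%:E)%E) ->
  l2closure f.
Proof.
move=> mf fcl; split=> // e e0.
(* The factor 2 of [sqnormD_le] turns two errors below e / 4 into one below e. *)
have e4 : 0 < e / 4 by rewrite divr_gt0.
have [g [mg /(_ _ e4)[h Dh gh]] fg] := fcl _ e4.
exists h => //; have mh := mD Dh.
have -> : (fun x => f x - h x) = (fun x => (f x - g x) + (g x - h x)).
  by apply/funext => x; rewrite addrA subrK.
apply: le_lt_trans (sqnormD_le _ _ _) _; try exact: measurable_funB.
have -> : e = 2 * (e / 4 + e / 4) by lra.
by rewrite EFinM lte_pmul2l// EFinD lteD.
Qed.

(** The differences f - u n tend to 0 pointwise and are dominated by 2 |h|, so some u n is close to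
    f in mean square. *)
Lemma l2closure_dominated (u : nat -> S -> R) f h :
  (forall n, l2closure (u n)) -> (forall x, u n x @[n --> \oo] --> f x) ->
  measurable_fun setT h -> (sqnorm mu h < +oo)%E ->
  (forall n x, `|u n x| <= `|h x|) -> l2closure f.
Proof.
move=> clu uf mh hoo uh.
have mf : measurable_fun setT f.
  by apply: (@measurable_fun_cvg _ _ _ _ u) => [n|x _]; [have [] := clu n|exact: uf].
have fh x : `|f x| <= `|h x|.
  by apply: (cvgn_norm_le (uf x)) => n; exact: uh.
apply: l2closure_closed => // e e0.
have mfu n : measurable_fun setT (fun x => f x - u n x).
  by apply: measurable_funB => //; have [] := clu n.
have fu0 x : f x - u n x @[n --> \oo] --> (0 : R).
  by rewrite -[X in _ --> X](subrr (f x)); apply: cvgB => //; exact: cvg_cst.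
have m2h : measurable_fun setT (fun x => 2 * h x) by apply: measurable_funM.
have h2oo : (sqnorm mu (fun x => 2 * h x)%R < +oo)%E.
  by rewrite sqnormZ// lte_mul_pinfty.
have fuh n x : `|f x - u n x| <= `|2 * h x|.
  rewrite normrM ger0_norm// (le_trans (ler_normB _ _))//.
  by rewrite mulr_natl mulr2n lerD.
have [N _ /(_ N (leqnn N)) /= uN] :=
  cvge0_lt (sqnorm_dominated_cvg0 mfu fu0 m2h h2oo fuh) e0.
by exists (u N).
Qed.

Lemma l2closureD f g : l2closure f -> l2closure g -> l2closure (fun x => f x + g x).
Proof.
move=> [mf clf] [mg clg]; split=> [|e e0]; first exact: measurable_funD.
have e4 : 0 < e / 4 by rewrite divr_gt0.
have [f' Df' ff'] := clf _ e4; have [g' Dg' gg'] := clg _ e4.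
exists (fun x => f' x + g' x); first exact: addD.
have -> : (fun x => f x + g x - (f' x + g' x)) =
    (fun x => (f x - f' x) + (g x - g' x)).
  by apply/funext => x; rewrite opprD addrACA.
have mf' := mD Df'; have mg' := mD Dg'.
apply: le_lt_trans (sqnormD_le _ _ _) _; try exact: measurable_funB.
have -> : e = 2 * (e / 4 + e / 4) by lra.
by rewrite EFinM lte_pmul2l// EFinD lteD.
Qed.

Lemma l2closureZ (c : R) f : l2closure f -> l2closure (fun x => c * f x).
Proof.
move=> [mf clf]; split=> [|e e0]; first exact: measurable_funM.
(* The added 1 allows the division when c = 0. *)
have c0 : 0 < c ^+ 2 + 1 by rewrite ltr_wpDl// sqr_ge0.
have [g Dg fg] := clf _ (divr_gt0 e0 c0).
exists (fun x => c * g x); first exact: scaleD.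
under [X in sqnorm _ X]eq_fun do rewrite -mulrBr.
rewrite sqnormZ; last by apply: measurable_funB => //; exact: mD.
apply: (@le_lt_trans _ _ ((c ^+ 2 + 1)%:E * sqnorm mu (fun x => f x - g x)%R))%E.
  by apply: lee_wpmul2r; rewrite ?sqnorm_ge0// lee_fin lerDl.
by rewrite -lte_pdivlMl// -EFinM mulrC.
Qed.

(** Products are tested on [D] alone; boundedness extends the property to the whole closure in
    [multiplier_closure]. *)
Definition multiplier f := [/\ measurable_fun setT f,
  exists M : R, forall x, `|f x| <= M & forall g, D g -> l2closure (fun x => f x * g x)].

(** If h in [D] is close to g, then f h lies in the closure and |f g - f h| <= M |g - h|, so f g is
    a limit of elements of the closure. *)
Lemma multiplier_closure f g :
  multiplier f -> l2closure g -> l2closure (fun x => f x * g x).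
Proof.
move=> [mf [M fM] fD] [mg clg].
apply: l2closure_closed => [|e e0]; first exact: measurable_funM.
have M0 : 0 < M ^+ 2 + 1 by rewrite ltr_wpDl// sqr_ge0.
have [h Dh gh] := clg _ (divr_gt0 e0 M0); have mh := mD Dh.
exists (fun x => f x * h x); first exact: fD.
apply: (@le_lt_trans _ _ (sqnorm mu (fun x => M * (g x - h x))%R)%E).
  apply: sqnorm_le => [||x].
  - by apply: measurable_funB; exact: measurable_funM.
  - by apply: measurable_funM => //; exact: measurable_funB.
  - by rewrite -mulrBr !normrM ler_wpM2r// (le_trans (fM x))// ler_norm.
rewrite sqnormZ; last exact: measurable_funB.
apply: (@le_lt_trans _ _ ((M ^+ 2 + 1)%:E * sqnorm mu (fun x => g x - h x)%R))%E.
  by apply: lee_wpmul2r; rewrite ?sqnorm_ge0// lee_fin lerDl.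
by rewrite -lte_pdivlMl// -EFinM mulrC.
Qed.

Lemma multiplierM f g :
  multiplier f -> multiplier g -> multiplier (fun x => f x * g x).
Proof.
move=> Wf [mg [N gN] gD]; have [mf [M fM] fD] := Wf; split.
- exact: measurable_funM.
- by exists (M * N) => x; rewrite normrM ler_pM.
- move=> h Dh; under eq_fun do rewrite -mulrA.
  exact: (multiplier_closure Wf (gD _ Dh)).
Qed.

Lemma multiplierD f g :
  multiplier f -> multiplier g -> multiplier (fun x => f x + g x).
Proof.
move=> [mf [M fM] fD] [mg [N gN] gD]; split.
- exact: measurable_funD.
- by exists (M + N) => x; rewrite (le_trans (ler_normD _ _))// lerD.
- move=> h Dh; under eq_fun do rewrite mulrDl.
  exact: l2closureD (fD _ Dh) (gD _ Dh).
Qed.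

Lemma multiplier_cst (c : R) : multiplier (fun=> c).
Proof.
split; [exact: measurable_cst|by exists `|c| => x|].
by move=> h Dh; apply: l2closureZ; exact: sub_l2closure.
Qed.

Lemma multiplierB f g :
  multiplier f -> multiplier g -> multiplier (fun x => f x - g x).
Proof.
move=> Wf Wg; under eq_fun do rewrite -mulN1r.
by apply: multiplierD => //; apply: multiplierM => //; exact: multiplier_cst.
Qed.

Lemma multiplierX f n : multiplier f -> multiplier (fun x => f x ^+ n).
Proof.
move=> Wf; elim: n => [|n IH].
  by under eq_fun do rewrite expr0; exact: multiplier_cst.
by under eq_fun do rewrite exprS; exact: multiplierM.
Qed.

(** For fixed g in [D] the products u n * g are dominated by the square-integrable M g. *)
Lemma multiplier_lim (u : nat -> S -> R) f (M : R) :
  (forall n, multiplier (u n)) -> (forall n x, `|u n x| <= M) ->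
  (forall x, u n x @[n --> \oo] --> f x) -> multiplier f.
Proof.
move=> Wu uM uf; split.
- by apply: (@measurable_fun_cvg _ _ _ _ u) => [n|x _]; [have [] := Wu n|exact: uf].
- by exists M => x; apply: (cvgn_norm_le (uf x)) => n; exact: uM.
- move=> g Dg; have mg := mD Dg.
  apply: (@l2closure_dominated (fun n x => u n x * g x) _ (fun x => M * g x)).
  + by move=> n; have [_ _] := Wu n; exact.
  + by move=> x; apply: cvgMl; exact: uf.
  + exact: measurable_funM.
  + by rewrite sqnormZ// lte_mul_pinfty ?ltyD// lee_fin sqr_ge0.
  + by move=> n x; rewrite !normrM ler_wpM2r// (le_trans (uM n x))// ler_norm.
Qed.


(** Scale f to g with values in [-1, 1]. Then |g| is a bounded limit of polynomials in g, the
    positive part h of g takes values in [0, 1], and 1 - (1 - h)^n tends to the indicator of {h > 0}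
    = {f > 0}. *)
Lemma multiplier_gt0 f : multiplier f -> multiplier (\1_[set x | 0 < f x]).
Proof.
move=> Wf; have [_ [M fM] _] := Wf.
have M0 : 0 < `|M| + 1 by rewrite ltr_wpDl.
pose g x := (`|M| + 1)^-1 * f x.
have Wg : multiplier g by apply: multiplierM => //; exact: multiplier_cst.
have g1 x : `|g x| <= 1.
  rewrite normrM gtr0_norm ?invr_gt0// ler_pdivrMl// mulr1.
  by rewrite (le_trans (fM x))// (le_trans (ler_norm M))// lerDl.
have Wabs : multiplier (fun x => `|g x|).
  apply: (@multiplier_lim (fun n x => abs_approx (g x) n) _ 1).
  - elim=> [|n IH]; first exact: multiplier_cst.
    rewrite (_ : (fun x => _) = fun x => abs_approx (g x) n +
      (g x ^+ 2 - abs_approx (g x) n ^+ 2) * 2^-1)//.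
    apply: multiplierD => //; apply: multiplierM; last exact: multiplier_cst.
    by apply: multiplierB; exact: multiplierX.
  - move=> n x; have [? ? _] := abs_approx_bound n (g1 x).
    by rewrite ger0_norm// (le_trans _ (g1 x)).
  - by move=> x; exact: abs_approx_cvg.
pose h x := (g x + `|g x|) * 2^-1.
have Wh : multiplier h.
  by apply: multiplierM; [exact: multiplierD|exact: multiplier_cst].
have h01 x : 0 <= h x <= 1.
  by rewrite /h; have := g1 x; have := ler_norm (g x); have := ler_norm (- g x);
    rewrite normrN; lra.
have hf x : (0 < h x) = (0 < f x).
  rewrite -[RHS](@pmulr_rgt0 _ (`|M| + 1)^-1) ?invr_gt0// -/(g x) /h.
  by have [g0|g0] := leP (g x) 0; [rewrite ler0_norm// subrr mul0r ltxx|
    rewrite gtr0_norm//; apply/idP; lra].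
apply: (@multiplier_lim (fun n x => 1 - (1 - h x) ^+ n) _ 1).
- move=> n; apply: multiplierB; first exact: multiplier_cst.
  by apply: multiplierX; apply: multiplierB => //; exact: multiplier_cst.
- move=> n x; have /andP[h0 h1] := h01 x.
  have : 0 <= (1 - h x) ^+ n <= 1 by rewrite exprn_ge0 ?exprn_ile1 ?subr_ge0// gerBl.
  by move=> ?; rewrite ger0_norm; lra.
- move=> x; have -> : \1_[set y | 0 < f y] x = (0 < h x)%R%:R :> R.
    by rewrite indicE hf; congr (nat_of_bool _)%:R; apply/idP/idP; rewrite inE.
  exact: indic_gt0_cvg.
Qed.

(** A complement has indicator 1 - 1_A, and the indicator of a countable union is the limit of 1 -
    prod_(i < n) (1 - 1_(A i)). *)
Lemma sigma_algebra_multiplier :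
  sigma_algebra setT [set A | multiplier (\1_A : S -> R)].
Proof.
split=> /= [|A WA|A WA].
- by rewrite indic0; exact: multiplier_cst.
- rewrite (_ : \1_(_) = fun x => 1 - \1_A x).
    by apply: multiplierB => //; exact: multiplier_cst.
  apply/funext => x; rewrite !indicE setTD in_setC.
  by case: (x \in A); rewrite /= ?subrr ?subr0.
- pose u n x : R := 1 - \prod_(i < n) (1 - \1_(A i) x).
  have WC i : multiplier (fun x => 1 - \1_(A i) x).
    by apply: multiplierB => //; exact: multiplier_cst.
  have indic01 i x : 0 <= (1 - \1_(A i) x : R) <= 1.
    by rewrite indicE; case: (x \in A i); rewrite /= ?subrr ?subr0 ?lexx ?ler01.
  apply: (@multiplier_lim u _ 1).
  + move=> n; apply: multiplierB; first exact: multiplier_cst.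
    elim: n => [|n IH].
      by under eq_fun do rewrite big_ord0; exact: multiplier_cst.
    by under eq_fun do rewrite big_ord_recr /=; exact: multiplierM.
  + move=> n x; rewrite /u.
    have : 0 <= (\prod_(i < n) (1 - \1_(A i) x) : R) <= 1.
      rewrite prodr_ge0 ?prodr_ile1//= => i _; have /andP[]// := indic01 i x.
    by move=> ?; rewrite ger0_norm; lra.
  + move=> x; rewrite indicE; case: (boolP (x \in _)) => [|xA].
      rewrite inE => -[k _ Akx].
      (* If x lies in A k, the k-th factor vanishes and the product is 0 from n = k + 1 on. *)
      rewrite -[X in _ --> X]subr0; apply: cvg_near_cst; exists k.+1 => //= n kn.
      by rewrite /u (bigD1 (Ordinal kn))//= indicE mem_set// subrr mul0r.
    rewrite (_ : u^~ x = cst 0); first exact: cvg_cst.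
    apply/funext => n; rewrite /u big1 ?subrr// => i _.
    rewrite indicE memNset ?subr0// => Aix.
    by move/negP: xA; apply; rewrite inE; exists i.
Qed.

Context (genS : forall A, measurable A -> multiplier (\1_A : S -> R)).

(** A simple function is a finite combination of indicators, and 1_A = 1_A * 1 is a multiplier
    applied to an element of [D]. *)
Lemma l2closure_nnsfun (f : {nnsfun S >-> R}) : l2closure f.
Proof.
rewrite (_ : f = (fun x => \sum_(y \in range f) y * \1_(f @^-1` [set y]) x) :> (S -> R)).
  rewrite -[l2closure _]/(l2closure (fun x => _)).
  under eq_fun do rewrite fsbig_finite//.
  elim: (finmap.enum_fset _) => [|y s IH].
    under eq_fun do rewrite big_nil.
    rewrite (_ : (fun x => 0) = fun x => 0 * cst 1 x); last first.
      by apply/funext => x; rewrite mul0r.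
    by apply: l2closureZ; exact: sub_l2closure.
  under eq_fun do rewrite big_cons.
  apply: l2closureD => //; apply: l2closureZ.
  have [_ _ /(_ _ oneD)] := genS (measurable_funPTI f (measurable_set1 y)).
  by under eq_fun do rewrite mulr1.
by apply/funext => x; exact: fimfunE.
Qed.

(** A nonnegative f is the limit of simple functions dominated by f itself; in general f is the
    difference of its positive and negative parts. *)
Lemma l2closure_all f : measurable_fun setT f -> (sqnorm mu f < +oo)%E -> l2closure f.
Proof.
have cl_ge0 g : measurable_fun setT g -> (sqnorm mu g < +oo)%E ->
    (forall x, 0 <= g x) -> l2closure g.
  move=> mg goo g0.
  have mg' : measurable_fun setT (EFin \o g) by exact/measurable_EFinP.
  pose u n := nnsfun_approx measurableT mg' n.
  have u_cvg x : u n x @[n --> \oo] --> g x.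
    have /fine_cvg := cvg_nnsfun_approx measurableT mg' (fun x _ => g0 x) (I : setT x).
    exact.
  have ug n x : u n x <= g x.
    rewrite -(cvg_lim _ (u_cvg x))//; apply: nondecreasing_cvgn_le.
      by move=> a b ab; exact/lefP/nd_nnsfun_approx.
    by apply/cvg_ex; exists (g x).
  apply: (@l2closure_dominated (fun n x => u n x) g g) => //.
    by move=> n; exact: l2closure_nnsfun.
  by move=> n x; rewrite !ger0_norm.
move=> mf fin_f.
rewrite (_ : f = (fun x => Num.max (f x) 0 + (-1) * Num.max (- f x) 0)); last first.
  by apply/funext => x; case: (leP (f x) 0); case: (leP (- f x) 0); lra.
have mfN : measurable_fun setT (fun x => - f x).
  exact: (measurableT_comp (@oppr_measurable R setT)).
have mp : measurable_fun setT (fun x => Num.max (f x) 0) by exact: measurable_maxr.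
have mn : measurable_fun setT (fun x => Num.max (- f x) 0) by exact: measurable_maxr.
have maxf (y : R) : `|Num.max y 0| <= `|y|.
  by case: (leP y 0) => // _; rewrite normr0.
apply: l2closureD; last apply: l2closureZ; apply: cl_ge0 => //.
- by apply: le_lt_trans fin_f; exact: sqnorm_le.
- by move=> x; rewrite le_max lexx orbT.
- by apply: le_lt_trans fin_f; apply: sqnorm_le => // x; rewrite -[leRHS]normrN.
- by move=> x; rewrite le_max lexx orbT.
Qed.

End closure.

(** * Density of polynomials under exponential moments *)

(** The single term (e s)^k / k! of the exponential series is at most exp (e s). *)
Lemma expr_le_expR (R : realType) (s e : R) k : 0 <= s -> 0 < e ->
  s ^+ k <= k`!%:R / e ^+ k * expR (e * s).
Proof.
move=> s0 e0; have es0 : 0 <= e * s by rewrite mulr_ge0// ltW.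
have ek : 0 < e ^+ k by rewrite exprn_gt0.
rewrite mulrAC ler_pdivlMr// mulrC -exprMn -ler_pdivrMl ?ltr0n ?fact_gt0// mulrC.
case: k ek => [|k] _; last by rewrite (le_trans _ (expR_ge1Dxn k es0))// lerDr.
by rewrite expr0 fact0 divr1 (le_trans _ (expR_ge1Dx _))// lerDl.
Qed.

Lemma series_exp_coeff_le (R : realType) (t : R) n : 0 <= t ->
  series (exp_coeff t) n <= expR t.
Proof.
move=> t0; apply: nondecreasing_cvgn_le; last exact: is_cvg_series_exp_coeff.
by apply: nondecreasing_series => k _ _; exact: exp_coeff_ge0.
Qed.

(** * Polynomial functions: closure properties and growth *)

Section polynomials.
Context (R : realType) (d : nat).
Implicit Types (x : Rvec R d) (i : 'I_d).
Local Notation poly := (@polynomials R d).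

Lemma polynomialsD f g : poly f -> poly g -> poly (fun x => f x + g x).
Proof.
move=> [p _ <-] [q _ <-]; exists (p + q) => //.
by apply/funext => x; rewrite mevalD.
Qed.

Lemma polynomialsM f g : poly f -> poly g -> poly (fun x => f x * g x).
Proof.
move=> [p _ <-] [q _ <-]; exists (p * q) => //.
by apply/funext => x; rewrite mevalM.
Qed.

Lemma polynomials_cst (c : R) : poly (fun=> c).
Proof. by exists (mpolyC d c) => //; apply/funext => x; rewrite mevalC. Qed.

Lemma polynomialsZ (c : R) f : poly f -> poly (fun x => c * f x).
Proof. by apply: polynomialsM; exact: polynomials_cst. Qed.

Lemma polynomials_coord i : poly (fun x => tnth x i).
Proof. by exists (mpolyX R (mnm1 i)) => //; apply/funext => x; rewrite mevalXU. Qed.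

Lemma polynomialsX f n : poly f -> poly (fun x => f x ^+ n).
Proof.
move=> pf; elim: n => [|n IH].
  by under eq_fun do rewrite expr0; exact: polynomials_cst.
by under eq_fun do rewrite exprS; exact: polynomialsM.
Qed.

Lemma polynomials_sum (I : Type) (s : seq I) (F : I -> Rvec R d -> R) :
  (forall k, poly (F k)) -> poly (fun x => \sum_(i <- s) F i x).
Proof.
move=> pF; elim: s => [|i s IH].
  by under eq_fun do rewrite big_nil; exact: polynomials_cst.
by under eq_fun do rewrite big_cons; exact: polynomialsD.
Qed.

Lemma measurable_coord i : measurable_fun setT (fun x => tnth x i : R).
Proof. exact: measurable_tnth. Qed.

Lemma measurable_polynomials f : poly f -> measurable_fun setT f.
Proof.
move=> [p _ <-]; under eq_fun do rewrite mevalE.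
apply: measurable_sum => m; apply: measurable_funM => //.
by apply: measurable_prod => i _; apply: measurable_funX; exact: measurable_coord.
Qed.

Definition sumabs x : R := \sum_i `|tnth x i|.

Lemma sumabs_ge0 x : 0 <= sumabs x.
Proof. exact: sumr_ge0. Qed.

Lemma coord_le_sumabs x i : `|tnth x i : R| <= sumabs x.
Proof. by rewrite /sumabs (bigD1 i)//= lerDl sumr_ge0. Qed.

Lemma measurable_sumabs : measurable_fun setT sumabs.
Proof.
by apply: measurable_sum => i; apply: measurableT_comp => //; exact: measurable_coord.
Qed.

(** A monomial of degree k is at most [sumabs x] ^ k in absolute value, and [expr_le_expR] bounds
    this power by an exponential. *)
Lemma polynomials_growth f (e : R) : poly f -> 0 < e ->
  exists2 C : R, 0 <= C & forall x, `|f x| <= C * expR (e * sumabs x).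
Proof.
move=> [p _ <-] e0.
exists (\sum_(m <- msupp p) `|mcoeff m p| * ((mdeg m)`!%:R / e ^+ mdeg m)).
  apply: sumr_ge0 => m _; rewrite mulr_ge0// divr_ge0// exprn_ge0// ltW//.
move=> x; rewrite mevalE (le_trans (ler_norm_sum _ _ _))// mulr_suml.
apply: ler_sum => m _; rewrite normrM -mulrA ler_wpM2l//.
apply: le_trans (expr_le_expR _ (sumabs_ge0 x) e0).
rewrite normr_prod mdegE -prodrXr.
apply: ler_prod => i _; rewrite normr_ge0 normrX lerXn2r ?nnegrE ?sumabs_ge0//.
exact: coord_le_sumabs.
Qed.

End polynomials.

(** * Density under an exponential moment of the l^1 norm *)

Section density.
Context (R : realType) (d : nat) (mu : probability (Rvec R d) R) (b : R).
Context (b0 : 0 < b).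
Context (mu_exp : (\int[mu]_x (expR (b * sumabs x))%:E < +oo)%E).
Local Notation poly := (@polynomials R d).
Local Notation multiplier := (multiplier mu poly).

(** The common dominating function: halving b makes its square a multiple of the integrable exp (b *
    sumabs x). *)
Definition expbound (C : R) (x : Rvec R d) : R := C * expR (b / 2 * sumabs x).

Lemma measurable_expbound C : measurable_fun setT (expbound C).
Proof.
apply: measurable_funM => //; apply: measurableT_comp => //.
by apply: measurable_funM => //; exact: measurable_sumabs.
Qed.

Lemma expbound_lty C : (sqnorm mu (expbound C) < +oo)%E.
Proof.
rewrite (_ : expbound C = fun x => C * expbound 1 x); last first.
  by apply/funext => x; rewrite /expbound mul1r.
rewrite sqnormZ; last exact: measurable_expbound.
rewrite lte_mul_pinfty ?lee_fin ?sqr_ge0//.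
rewrite /sqnorm (eq_integral (fun x => (expR (b * sumabs x))%:E))// => x _.
by rewrite /expbound mul1r -expRM_natl; congr (expR _)%:E; lra.
Qed.

Lemma polynomials_lty f : poly f -> (sqnorm mu f < +oo)%E.
Proof.
move=> pf; have [|C C0 fC] := polynomials_growth pf (e := b / 2);
  first by rewrite divr_gt0.
apply: le_lt_trans (expbound_lty C); apply: sqnorm_le => [||x].
- exact: measurable_polynomials.
- exact: measurable_expbound.
- by rewrite (le_trans (fC x))// ler_norm.
Qed.

Let mD := @measurable_polynomials R d.

(** Serves both cos and sin. The partial sums times a polynomial q are polynomials. They are bounded
    by exp |s x_i| |q|, where each factor costs at most exp (b / 4 * sumabs x) up to a constant, so
    [expbound] dominates them. *)
Lemma multiplier_series (F : R -> R) (a : nat -> R) (s : R) i :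
  measurable_fun setT F -> (forall t, `|F t| <= 1) ->
  (forall n, `|a n| <= 1) ->
  (forall t, \sum_(k < n) a k * exp_coeff t k @[n --> \oo] --> F t) ->
  `|s| <= b / 4 -> multiplier (fun x => F (s * tnth x i)).
Proof.
move=> mF F1 a1 aF sb; split.
- apply: measurableT_comp => //; apply: measurable_funM => //; exact: measurable_coord.
- by exists 1.
move=> q pq; have [|C C0 qC] := polynomials_growth pq (e := b / 4);
  first by rewrite divr_gt0.
apply: (@l2closure_dominated _ _ _ _ _ mD (fun n x =>
   (\sum_(k < n) a k * exp_coeff (s * tnth x i) k) * q x) _ (expbound C)).
- move=> n; apply: sub_l2closure; first exact: mD.
  apply: polynomialsM => //; apply: polynomials_sum => k.
  apply: polynomialsZ; apply: polynomialsM; last exact: polynomials_cst.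
  by apply: polynomialsX; apply: polynomialsZ; exact: polynomials_coord.
- by move=> x; apply: cvgMl; exact: aF.
- exact: measurable_expbound.
- exact: expbound_lty.
move=> n x; rewrite normrM [`|expbound C x|]ger0_norm; last by rewrite mulr_ge0 ?expR_ge0.
have -> : expbound C x = expR (b / 4 * sumabs x) * (C * expR (b / 4 * sumabs x)).
  by rewrite /expbound mulrCA -expRD; congr (_ * expR _); lra.
rewrite ler_pM//.
apply: (@le_trans _ _ (expR `|s * tnth x i|)); last first.
  rewrite ler_expR normrM ler_pM//; exact: coord_le_sumabs.
apply: le_trans (series_exp_coeff_le n (normr_ge0 _)).
rewrite seriesEord/= (le_trans (ler_norm_sum _ _ _))//.
apply: ler_sum => k _; rewrite normrM /exp_coeff/= normrM normrX.
rewrite [`|_^-1|]ger0_norm ?invr_ge0//.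
by rewrite ler_piMl// mulr_ge0// exprn_ge0.
Qed.

Lemma multiplier_cos (s : R) i :
  `|s| <= b / 4 -> multiplier (fun x => cos (s * tnth x i)).
Proof.
apply: (@multiplier_series _ (fun n => (~~ odd n)%:R * (-1) ^+ n./2)).
- by apply: continuous_measurable_fun; exact: continuous_cos.
- exact: cos_max.
- move=> n; rewrite normrM normrX normrN1 expr1n mulr1.
  by case: odd; rewrite /= ?normr0 ?normr1.
- move=> t; have := @is_cvg_series_cos_coeff R t.
  have -> : cos t = lim (series (cos_coeff t) @ \oo) by rewrite unlock.
  rewrite (_ : (fun n => _) = series (cos_coeff t))//.
  apply/funext => n; rewrite seriesEord/=; apply: eq_bigr => k _.
  by rewrite /cos_coeff /exp_coeff/= !mulrA.
Qed.

Lemma multiplier_sin (s : R) i :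
  `|s| <= b / 4 -> multiplier (fun x => sin (s * tnth x i)).
Proof.
apply: (@multiplier_series _ (fun n => (odd n)%:R * (-1) ^+ n.-1./2)).
- by apply: continuous_measurable_fun; exact: continuous_sin.
- exact: sin_max.
- move=> n; rewrite normrM normrX normrN1 expr1n mulr1.
  by case: odd; rewrite /= ?normr0 ?normr1.
- move=> t; have := @is_cvg_series_sin_coeff R t.
  have -> : sin t = lim (series (sin_coeff t) @ \oo) by rewrite unlock.
  rewrite (_ : (fun n => _) = series (sin_coeff t))//.
  apply/funext => n; rewrite seriesEord/=; apply: eq_bigr => k _.
  by rewrite /sin_coeff /exp_coeff/= !mulrA.
Qed.

Lemma sin_gt0_small (t : R) : `|t| <= 1 -> (0 < sin t) = (0 < t).
Proof.
have pos (u : R) : 0 < u -> u <= 1 -> 0 < sin u.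
  by move=> u0 u1; rewrite sin_gt0_pi// u0; have := @pi_ge2 R; lra.
rewrite ler_norml => /andP[t1 t2]; have [t0|t0|->] := ltgtP t 0.
- by apply/negP; have := pos (- t); rewrite sinN; lra.
- by rewrite pos.
- by rewrite sin0 ltxx.
Qed.

(** For small s the addition formula makes sin (s (x_i - c)) a multiplier. It has the sign of x_i -
    c once s |x_i - c| <= 1, so along s n -> 0 the indicators of its positivity set are eventually
    constant at each point. *)
Lemma multiplier_coord_gt i (c : R) :
  multiplier (\1_[set x : Rvec R d | c < tnth x i]).
Proof.
(* The shift by N > 4 / b gives s n <= b / 4 already at n = 0. *)
pose N := Num.Def.archi_bound (4 / b).
pose s n : R := (n + N).+1%:R^-1.
have sb n : `|s n| <= b / 4.
  have := archi_boundP (ltW (divr_gt0 (ltr0Sn R 3) b0)).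
  rewrite -/N => bN; rewrite ger0_norm ?invr_ge0//.
  rewrite -[leRHS]invrK lef_pV2 ?posrE ?invr_gt0 ?divr_gt0// invf_div.
  by rewrite (le_trans (ltW bN))// ler_nat leqW// leq_addl.
pose u n x := sin (s n * tnth x i - s n * c).
have Wu n : multiplier (\1_[set x | 0 < u n x]).
  apply: (multiplier_gt0 mD polynomials_lty (@polynomialsD R d) (@polynomialsZ R d)).
  rewrite /u; under eq_fun do rewrite sinB.
  have Wc (e : R) := multiplier_cst mu mD (@polynomialsZ R d) e.
  apply: (multiplierB mD (@polynomialsD R d) (@polynomialsZ R d));
    apply: (multiplierM mD) (Wc _).
    exact: multiplier_sin.
  exact: multiplier_cos.
apply: (@multiplier_lim _ _ _ _ _ mD polynomials_lty
  (fun n => \1_[set x | 0 < u n x]) _ 1) => // [n x|x].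
  by rewrite indicE; case: (_ \in _); rewrite /= ?normr0 ?normr1.
apply: cvg_near_cst.
(* From n = M > |t| on, s n * |t| <= 1. *)
pose t : R := tnth x i - c; pose M := Num.Def.archi_bound `|t|.
exists M => // n /= Mn; rewrite !indicE; congr (nat_of_bool _)%:R.
have sn0 : 0 < s n by rewrite invr_gt0.
have st : `|s n * t| <= 1.
  rewrite normrM gtr0_norm// mulrC ler_pdivrMr// mul1r.
  rewrite (le_trans (ltW (archi_boundP (normr_ge0 t))))// ler_nat leqW//.
  by rewrite (leq_trans Mn)// leq_addr.
have -> : (x \in [set x | 0 < u n x]) = (0 < u n x) by apply/idP/idP; rewrite inE.
rewrite /u -mulrBr sin_gt0_small// pmulr_rgt0// subr_gt0.
by apply/idP/idP; rewrite inE.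
Qed.

(** The Borel sets of R^d are generated by the sets {x_i in C} with C Borel, and the Borel sets of R
    by the rays (c, +oo). For each i, the C for which the indicator of {x_i in C} is a multiplier
    form a sigma-algebra. *)
Lemma multiplier_indic (A : set (Rvec R d)) :
  measurable A -> multiplier (\1_A : Rvec R d -> R).
Proof.
have sa := sigma_algebra_multiplier mD polynomials_lty
  (@polynomialsD R d) (@polynomialsZ R d) :
  sigma_algebra _ [set A | multiplier (\1_A : Rvec R d -> R)].
apply: (smallest_sub sa) => B; rewrite -bigcup_seq => -[i _ [C mC <-]].
have sai := sigma_algebra_image (fun x : Rvec R d => tnth x i : R) sa.
suff : image_set_system setT (fun x : Rvec R d => tnth x i : R)
  [set A | multiplier (\1_A : Rvec R d -> R)] C by [].
move: C mC; rewrite RGenOInfty.measurableE; apply: (smallest_sub sai).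
move=> _ [c ->]; rewrite /image_set_system/= setTI.
rewrite (_ : _ @^-1` _ = [set x | c < tnth x i]); first exact: multiplier_coord_gt.
by apply/seteqP; split => x /=; rewrite in_itv/= andbT.
Qed.

Lemma l2closure_polynomials f : measurable_fun setT f -> (sqnorm mu f < +oo)%E ->
  l2closure mu poly f.
Proof.
apply: (l2closure_all mD (@polynomialsD R d) (@polynomialsZ R d)).
  exact: polynomials_cst.
exact: multiplier_indic.
Qed.

End density.

(** * From the two alternative assumptions to an exponential moment of the l^1 norm *)

Section moments.
Context (R : realType) (disp : measure_display) (T : measurableType disp).
Context (P : probability T R) (d : nat) (X : {RV P >-> Rvec R d}).

Lemma measurable_RV_coord i : measurable_fun setT (fun w => tnth (X w) i : R).
Proof. by apply: (measurableT_comp (measurable_coord i)). Qed.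

Lemma measurable_exp_coord (a : R) i :
  measurable_fun setT (fun w => (expR (a * `|(tnth (X w) i : R)|))%:E).
Proof.
apply/measurable_EFinP; apply: measurableT_comp => //; apply: measurable_funM => //.
by apply: measurableT_comp => //; exact: measurable_RV_coord.
Qed.

Lemma compact_range_exp_moments : compact_range X -> exp_moments X.
Proof.
move=> [K cK XK]; exists 1 => // i.
have : compact ((fun v : 'rV[R]_d => v ord0 i) @` K).
  apply: continuous_compact => //; apply: continuous_subspaceT => v.
  exact: coord_continuous.
(* Boundedness is stated for every constant strictly above M, hence M + 1. *)
move=> /compact_bounded[M [_ /(_ (M + 1))]]; rewrite ltrDl ltr01 => /(_ isT) KM.
rewrite unlock; apply: (@le_lt_trans _ _ (\int[P]_w (expR (M + 1))%:E)%E); last first.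
  by rewrite integral_cst//= probability_setT mule1 ltry.
apply: ae_ge0_le_integral => //.
- exact: measurable_exp_coord.
- apply: filterS XK => w Kw _; rewrite lee_fin ler_expR mul1r.
  by apply: KM; exists (\row_j tnth (X w) j) => //; rewrite mxE.
Qed.

(** If some |x_i| is at least [sumabs x] / (d + 1), the i-th exponential suffices. Otherwise summing
    over i gives (d + 1) [sumabs x] <= d [sumabs x], so [sumabs x] <= 0 and the summand 1 suffices.
    With d + 1 in the denominator the case d = 0 is covered. *)
Lemma expR_sumabs_le (a : R) (x : Rvec R d) : 0 < a ->
  expR (a / d.+1%:R * sumabs x) <= 1 + \sum_i expR (a * `|(tnth x i : R)|).
Proof.
move=> a0; have [/existsP[i xi]|] :=
  boolP [exists i, sumabs x <= d.+1%:R * `|(tnth x i : R)|].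
  apply: (@le_trans _ _ (expR (a * `|(tnth x i : R)|))).
    by rewrite ler_expR -mulrA ler_pM2l// ler_pdivrMl.
  rewrite (bigD1 i)//= addrCA lerDl addr_ge0// sumr_ge0// => j _; exact: expR_ge0.
rewrite negb_exists => /forallP xS.
have : d.+1%:R * sumabs x <= d%:R * sumabs x.
  have -> : d%:R * sumabs x = \sum_(i < d) sumabs x.
    by rewrite sumr_const card_ord mulr_natl.
  by rewrite [X in _ * X]/sumabs mulr_sumr; apply: ler_sum => i _; rewrite ltW// ltNge.
rewrite -natr1 mulrDl mul1r gerDl => S0.
apply: (@le_trans _ _ (expR 0)).
  by rewrite ler_expR pmulr_rle0// divr_gt0.
by rewrite expR0 lerDl sumr_ge0// => j _; exact: expR_ge0.
Qed.

Lemma exp_moments_sumabs : exp_moments X ->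
  exists2 b : R, 0 < b & (\int[distribution P X]_x (expR (b * sumabs x))%:E < +oo)%E.
Proof.
move=> [a a0 aX]; exists (a / d.+1%:R); first by rewrite divr_gt0.
have mS : measurable_fun setT (fun x : Rvec R d => (expR (a / d.+1%:R * sumabs x))%:E).
  apply/measurable_EFinP; apply: measurableT_comp => //; apply: measurable_funM => //.
  exact: measurable_sumabs.
rewrite ge0_integral_distribution//.
have ge0 (i : 'I_d) w : setT w -> (0 <= (expR (a * `|(tnth (X w) i : R)|))%:E)%E.
  by rewrite lee_fin expR_ge0.
apply: (@le_lt_trans _ _
  (\int[P]_w (1 + \sum_i (expR (a * `|(tnth (X w) i : R)|))%:E))%E).
  apply: ge0_le_integral => //.
  - by move=> w _; rewrite lee_fin expR_ge0.
  - exact: (measurableT_comp mS).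
  - apply: emeasurable_funD => //; apply: emeasurable_sum => i.
    exact: measurable_exp_coord.
  - by move=> w _; rewrite /= sumEFin -EFinD lee_fin expR_sumabs_le.
rewrite ge0_integralD//; first last.
- by apply: emeasurable_sum => i; exact: measurable_exp_coord.
- by move=> w _; rewrite sume_ge0// => i _; exact: ge0.
rewrite integral_cst//= probability_setT mule1.
rewrite ge0_integral_sum//; first last.
- by move=> i; exact: measurable_exp_coord.
rewrite lte_add_pinfty ?ltry//; apply: lte_sum_pinfty => i _.
by have := aX i; rewrite unlock.
Qed.

End moments.

(** * Zero sets of polynomials *)

Section zero_set.
Context (R : realType).

Definition mpoly_zeros d (q : mpoly d R) := [set x : Rvec R d | meval (tnth x) q = 0].

Lemma measurable_mpoly_zeros d (q : mpoly d R) : measurable (mpoly_zeros q).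
Proof.
have mq : measurable_fun setT (fun x : Rvec R d => meval (tnth x) q).
  by apply: measurable_polynomials; exists q.
by have := mq measurableT [set 0] (measurable_set1 _); rewrite setTI.
Qed.

Definition mnm_behead d (m : multinom d.+1) : multinom d :=
  Multinom [tuple m (lift ord0 i) | i < d].

Lemma mnm_beheadE d (m : multinom d.+1) i : mnm_behead m i = m (lift ord0 i).
Proof. by rewrite multinomE tnth_mktuple. Qed.

Lemma mnm_behead_inj d (m n : multinom d.+1) :
  m ord0 = n ord0 -> mnm_behead m = mnm_behead n -> m = n.
Proof.
move=> mn0 mn; apply/mnmP => i; case: (unliftP ord0 i) => [j ->|->//].
by rewrite -!mnm_beheadE mn.
Qed.

(** The polynomial q(a, .) in the last d variables, matching the sections of the product measure in
    [lebesgue_step]. *)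
Definition mpoly_section d (q : mpoly d.+1 R) (a : R) : mpoly d R :=
  \sum_(m <- msupp q) (mcoeff m q * a ^+ m ord0) *: mpolyX R (mnm_behead m).

Lemma meval_section d (q : mpoly d.+1 R) (a : R) (t : Rvec R d) :
  meval (tnth (consT (a, t))) q = meval (tnth t) (mpoly_section q a).
Proof.
rewrite mevalE raddf_sum; apply: eq_bigr => m _.
rewrite /= mevalZ mevalX big_ord_recl -mulrA; congr (_ * (_ * _)).
by apply: eq_bigr => i _; rewrite mnm_beheadE tnthS.
Qed.

(** The coefficient of x^k when q is read as a polynomial in the last d variables over the
    polynomials in the first. *)
Definition section_coef d (q : mpoly d.+1 R) (k : multinom d) : {poly R} :=
  \sum_(m <- msupp q | mnm_behead m == k) mcoeff m q *: 'X^(m ord0).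

Lemma mcoeff_section d (q : mpoly d.+1 R) (a : R) (k : multinom d) :
  mcoeff k (mpoly_section q a) = (section_coef q k).[a].
Proof.
rewrite raddf_sum horner_sum [RHS]big_mkcond/=; apply: eq_bigr => m _.
rewrite mcoeffZ mcoeffX; case: ifP => _; last by rewrite mulr0.
by rewrite hornerZ hornerXn mulr1.
Qed.

(** Its coefficient of degree [m ord0] is that of m in q: head and tail determine a multi-index, so
    no other term contributes. *)
Lemma section_coef_neq0 d (q : mpoly d.+1 R) m :
  m \in msupp q -> section_coef q (mnm_behead m) != 0.
Proof.
move=> qm; apply/eqP => /(congr1 (fun p : {poly R} => p`_(m ord0))).
rewrite coef0 coef_sum -big_filter (bigD1_seq m)/=; first last.
- by rewrite filter_uniq// msupp_uniq.
- by rewrite mem_filter eqxx.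
rewrite coefZ coefXn eqxx mulr1 big_filter_cond big1 ?addr0 => [q0|n].
  by move: qm; rewrite mcoeff_msupp q0 eqxx.
move=> /andP[/eqP nm]; rewrite coefZ coefXn => n'm.
case: eqP => [mn|_]; last by rewrite mulr0.
by move: n'm; rewrite (mnm_behead_inj (esym mn) nm) eqxx.
Qed.

Lemma finite_roots (r : {poly R}) : r != 0 -> finite_set [set a | r.[a] = 0].
Proof.
move=> r0; apply: contrapT => /(@infinite_set_fset _ _ (size r))[B Br rB].
have : (size (finmap.enum_fset B) < size r)%N.
  apply: max_poly_roots => //; last exact: finmap.fset_uniq.
  by apply/allP => a aB; apply/rootP; exact: Br.
by rewrite ltnNge rB.
Qed.

(** Induction on d, integrating over the first variable. For m in the support of q, [section_coef]
    at the tail of m has finitely many roots; for any other a the section q(a, .) is nonzero, so its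
    zero set is null. For d = 0, q is a nonzero constant. *)
Lemma lebesgue_mpoly_zeros d (q : mpoly d R) : q != 0 ->
  lebesgue R d (mpoly_zeros q) = 0%E.
Proof.
elim: d q => [|d IH] q q0.
  have qE : q = mpolyC 0 (mcoeff (@mnm0 0) q).
    apply/mpolyP => m; rewrite mcoeffC.
    have -> : m = @mnm0 0 by apply/mnmP => -[].
    by rewrite eqxx mulr1.
  have c0 : mcoeff (@mnm0 0) q != 0.
    by apply: contra_neq q0 => c0; rewrite qE c0 mpolyC0.
  rewrite /= diracE memNset// /mpoly_zeros/= qE mevalC.
  exact/eqP.
have [m qm] : exists m, m \in msupp q.
  case E : (msupp q) => [|m s]; last by exists m; rewrite mem_head.
  by move: q0; rewrite (msuppnil0 E) eqxx.
pose Z := [set a : R | (section_coef q (mnm_behead m)).[a] = 0].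
have fZ : finite_set Z by apply: finite_roots; exact: section_coef_neq0.
pose A := @consT R d @^-1` mpoly_zeros q.
have mA : measurable A.
  rewrite -[X in measurable X]setTI; apply: measurable_consT => //.
  exact: measurable_mpoly_zeros.
have secA a : xsection A a = mpoly_zeros (mpoly_section q a).
  apply/seteqP; split=> t; rewrite /xsection/= inE /A /mpoly_zeros/=;
    by rewrite meval_section.
rewrite /= /lebesgue_step /pushforward -/A /product_measure1.
rewrite (ae_eq_integral (cst 0%E))//.
- by rewrite integral0.
- exact: measurable_fun_xsection.
exists Z; split => //.
- have := @measurable_poly _ (section_coef q (mnm_behead m)) setT measurableT _
    (measurable_set1 0).
  by rewrite setTI.
- by apply: countable_lebesgue_measure0; exact: finite_set_countable.
move=> a /= H; apply: contrapT => Za; apply: H => _ /=.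
rewrite secA IH//; apply/eqP => s0; apply: Za.
by rewrite /Z/= -mcoeff_section s0 mcoeff0.
Qed.

End zero_set.

(** * Moment matrix and chaos expansion *)

Section grlex.
Context (R : realType) (d p : nat).
Local Notation alpha i := (nth (@mnm0 d) (grlex d p) i).

(** Identifies row vectors with the polynomials of degree at most p: injective by [grlex_mpoly_eq0],
    onto by [grlex_mpolyK], where [msize] is the degree plus one for q nonzero. *)
Definition grlex_mpoly (v : 'rV[R]_('C(d + p, d))) : mpoly d R :=
  \sum_i v ord0 i *: mpolyX R (alpha i).

Lemma meval_grlex v (x : Rvec R d) :
  meval (tnth x) (grlex_mpoly v) = (v *m monomials p x) ord0 ord0.
Proof.
rewrite raddf_sum mxE; apply: eq_bigr => i _.
by rewrite /= mevalZ mevalX mxE.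
Qed.

Lemma mcoeff_grlex v m :
  mcoeff m (grlex_mpoly v) = \sum_i v ord0 i * (alpha i == m)%:R.
Proof. by rewrite raddf_sum; apply: eq_bigr => i _; rewrite /= mcoeffZ mcoeffX. Qed.

Lemma mcoeff_grlex_nth v (i : 'I_('C(d + p, d))) :
  mcoeff (alpha i) (grlex_mpoly v) = v ord0 i.
Proof.
rewrite mcoeff_grlex (bigD1 i)//= eqxx mulr1 big1 ?addr0// => j ji.
rewrite nth_uniq ?size_grlex ?grlex_uniq// (_ : _ == _ = false) ?mulr0//.
exact: negbTE.
Qed.

Lemma grlex_mpoly_eq0 v : grlex_mpoly v = 0 -> v = 0.
Proof.
by move=> v0; apply/rowP => i; rewrite -mcoeff_grlex_nth v0 mcoeff0 mxE.
Qed.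

Lemma grlex_mpolyK (q : mpoly d R) : (msize q <= p.+1)%N ->
  grlex_mpoly (\row_i mcoeff (alpha i) q) = q.
Proof.
move=> qp; apply/mpolyP => m; have [mp|mp] := leqP (mdeg m) p.
  have mg : (index m (grlex d p) < 'C(d + p, d))%N.
    by rewrite -size_grlex index_mem mem_grlex.
  have -> : m = alpha (Ordinal mg) by rewrite nth_index// mem_grlex.
  by rewrite mcoeff_grlex_nth mxE.
rewrite mcoeff_grlex big1 => [|i _]; last first.
  case: eqP => [im|_]; last by rewrite mulr0.
  have : alpha i \in grlex d p by rewrite mem_nth// size_grlex.
  by rewrite mem_grlex im leqNgt mp.
by apply/esym/memN_msupp_eq0/msize_mdeg_ge; exact: leq_trans mp.
Qed.

Lemma polynomials_row (v : 'rV[R]_('C(d + p, d))) :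
  polynomials (fun x : Rvec R d => (v *m monomials p x) ord0 ord0).
Proof. by exists (grlex_mpoly v) => //; apply/funext => x; rewrite meval_grlex. Qed.

Lemma polynomials_monomials (i : 'I_('C(d + p, d))) :
  polynomials (fun x : Rvec R d => monomials p x i ord0).
Proof.
by exists (mpolyX R (alpha i)) => //; apply/funext => x; rewrite mevalX mxE.
Qed.

End grlex.

(** * Invertibility of the moment matrix and the span of the chaos basis *)

Section chaos.
Context (R : realType) (disp : measure_display) (T : measurableType disp).
Context (P : probability T R) (d : nat) (X : {RV P >-> Rvec R d}).
Local Notation mu := (distribution P X).
Local Notation poly := (@polynomials R d).

Lemma sqdistE y z : measurable_fun setT y -> measurable_fun setT z ->
  sqdist X y z = sqnorm mu (fun x => y x - z x).
Proof.
move=> my mz; rewrite /sqdist /sqnorm unlock ge0_integral_distribution//.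
  by apply: measurable_sqr; exact: measurable_funB.
by move=> x; rewrite lee_fin sqr_ge0.
Qed.

Lemma L2E y : L2 X y <-> measurable_fun setT y /\ (sqnorm mu y < +oo)%E.
Proof.
suff E : measurable_fun setT y -> sqnorm mu y = ('E_P[fun w => (y (X w) ^+ 2)%R])%E.
  by split=> -[my]; [rewrite -E//|rewrite E//].
move=> my; rewrite /sqnorm unlock ge0_integral_distribution//.
  exact: measurable_sqr.
by move=> x; rewrite lee_fin sqr_ge0.
Qed.

Context (b : R) (b0 : 0 < b).
Context (mu_exp : (\int[mu]_x (expR (b * sumabs x))%:E < +oo)%E).

Lemma integrable_polynomials f : poly f -> P.-integrable setT (EFin \o (f \o X)).
Proof.
move=> pf; have mf := measurable_polynomials pf.
have [C C0 fC] := polynomials_growth pf b0.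
apply/integrableP; split.
  by apply/measurable_EFinP; exact: measurableT_comp.
have mexp : measurable_fun setT (fun x : Rvec R d => (expR (b * sumabs x))%:E).
  apply/measurable_EFinP; apply: measurableT_comp => //; apply: measurable_funM => //.
  exact: measurable_sumabs.
have mX : measurable_fun setT X by [].
apply: (@le_lt_trans _ _ (\int[P]_w (C%:E * (expR (b * sumabs (X w)))%:E))%E).
  apply: ge0_le_integral => //.
  - apply: measurableT_comp => //; apply/measurable_EFinP; exact: measurableT_comp.
  - by apply: measurable_funeM; exact: (measurableT_comp mexp).
  - by move=> w _; rewrite /= lee_fin; exact: fC.
rewrite ge0_integralZl_EFin//; last exact: (measurableT_comp mexp).
rewrite lte_mul_pinfty// (le_lt_trans _ mu_exp)// ge0_integral_distribution//.
Qed.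

(** Expand the square and integrate termwise. Products of monomials are integrable, so [fine] in
    [moment_mx] loses nothing. *)
Lemma moment_quad p (v : 'rV[R]_('C(d + p, d))) :
  sqnorm mu (fun x => (v *m monomials p x) ord0 ord0) =
  ((v *m moment_mx X p *m v^T) ord0 ord0)%:E.
Proof.
pose B i j (w : T) : R := monomials p (X w) i ord0 * monomials p (X w) j ord0.
have iB i j : P.-integrable setT (fun w => (B i j w)%:E).
  apply: (@integrable_polynomials (fun x => monomials p x i ord0 * monomials p x j ord0)).
  by apply: polynomialsM; exact: polynomials_monomials.
have ivB i j c : P.-integrable setT (fun w => c%:E * (B i j w)%:E)%E.
  exact: integrableZl.
have BE i j : (\int[P]_w (B i j w)%:E = (moment_mx X p i j)%:E)%E.
  rewrite mxE unlock.
  have BEw w : (monomials p (X w) *m (monomials p (X w))^T) i j = B i j w.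
    by rewrite [LHS]mxE big_ord1 [X in _ * X]mxE.
  under [in RHS]eq_integral do rewrite BEw.
  by rewrite fineK//; apply: integrable_fin_num => //; exact: iB.
have mq : measurable_fun setT (fun x => (v *m monomials p x) ord0 ord0).
  by apply: measurable_polynomials; exact: polynomials_row.
rewrite /sqnorm ge0_integral_distribution; [|exact: measurable_sqr|]; last first.
  by move=> x; rewrite lee_fin sqr_ge0.
rewrite (eq_integral (fun w =>
  \sum_k \sum_j ((v ord0 j * v ord0 k)%:E * (B j k w)%:E)%E)) => [|w _].
  rewrite integral_sum// => [|k]; last by apply: integrable_sum.
  rewrite mxE -sumEFin; apply: eq_bigr => k _.
  rewrite integral_sum// mxE mulr_suml -sumEFin; apply: eq_bigr => j _.
  by rewrite integralZl// BE -EFinM !mxE mulrAC.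
rewrite /= mxE expr2 mulr_sumr -sumEFin; apply: eq_bigr => k _.
rewrite mulr_suml -sumEFin; apply: eq_bigr => j _.
by rewrite -EFinM; congr EFin; rewrite /B; ring.
Qed.

(** If v M = 0, then E[(v b(xi))^2] = 0 and the polynomial v b vanishes almost surely. Were v
    nonzero, its zero set would be Lebesgue-null, hence null for the law of xi by the density, and
    two null sets would cover a space of mass 1. *)
Lemma moment_mx_unit rho p : joint_density X rho -> moment_mx X p \in unitmx.
Proof.
move=> [mrho _ rhoX]; rewrite -row_free_unit; apply: inj_row_free => v vM.
apply/grlex_mpoly_eq0/eqP/negP => /negP q0.
set q := grlex_mpoly v in q0.
have mZ := measurable_mpoly_zeros q.
have Z0 : mu (mpoly_zeros q) = 0%E.
  rewrite [LHS]rhoX// null_set_integral//; last exact: lebesgue_mpoly_zeros.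
  by apply/measurable_EFinP; exact: measurable_funTS.
have mq : measurable_fun setT (fun x => (v *m monomials p x) ord0 ord0).
  by apply: measurable_polynomials; exact: polynomials_row.
have : (\int[mu]_x `|(((v *m monomials p x) ord0 ord0) ^+ 2)%:E| = 0)%E.
  under eq_integral do rewrite gee0_abs ?lee_fin ?sqr_ge0//.
  by rewrite -[LHS]/(sqnorm _ _) moment_quad vM mul0mx mxE.
move=> /ae_eq_integral_abs; case=> //; first exact: measurable_sqr.
move=> N [mN N0 qN].
have : (mu setT <= mu (N `|` mpoly_zeros q))%E.
  apply: le_measure; rewrite ?inE//; first exact: measurableU.
  move=> x _; have [?|Nx] := pselect (N x); [by left|right].
  rewrite /mpoly_zeros/= meval_grlex; apply: contrapT => qx.
  apply: Nx; apply: qN => /= /(_ I) [] /eqP; rewrite sqrf_eq0 => /eqP; exact: qx.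
rewrite probability_setT => /le_trans/(_ (measureU2 _ mN mZ)).
by rewrite [X in (_ <= X + _)%E]N0 [X in (_ <= _ + X)%E]Z0 adde0 lee_fin ler10.
Qed.

Lemma chaos_sum_polynomials p L c : poly (@chaos_sum R d p L c).
Proof.
have -> : chaos_sum L c = fun x : Rvec R d =>
    ((\row_i c i *m invmx L) *m monomials p x) ord0 ord0.
  apply/funext => x; rewrite -mulmxA mxE; apply: eq_bigr => i _.
  by rewrite [(\row__ _) _ _]mxE.
exact: polynomials_row.
Qed.

(** A polynomial v b equals (v L) (L^-1 b), so v L is its vector of chaos coefficients. *)
Lemma polynomials_chaos_sum p L (q : mpoly d R) : L \in unitmx -> (msize q <= p.+1)%N ->
  exists c, (fun x : Rvec R d => meval (tnth x) q) = @chaos_sum R d p L c.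
Proof.
move=> uL qp; rewrite -{1}(grlex_mpolyK qp); set v := \row_i _.
exists (fun i => (v *m L) ord0 i); apply/funext => x.
have vb : v *m monomials p x = (v *m L) *m chaos_basis L x.
  by rewrite /chaos_basis mulmxA mulmxK.
by rewrite meval_grlex vb [LHS]mxE.
Qed.

End chaos.

(** * Density of polynomials and mean-square convergence of chaos expansions *)

Theorem lemma2 (R : realType) (disp : measure_display)
    (T : measurableType disp) (P : probability T R)
    (d : nat) (X : {RV P >-> Rvec R d}) (rho : Rvec R d -> R) :
  joint_density X rho ->
  compact_range X \/ exp_moments X ->
  L2_dense X (@polynomials R d) /\
  (forall L : (forall p : nat, 'M[R]_('C(d + p, d))),
    (forall p, cholesky (moment_mx X p) (L p)) ->
    forall y : Rvec R d -> R, L2 X y ->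
    exists c : (forall p : nat, 'I_('C(d + p, d)) -> R),
      (fun p => sqdist X y (chaos_sum (L p) (c p))) @ \oo --> 0%E).
Proof.
move=> rhoX XB.
have {XB} Xexp : exp_moments X by case: XB => // /compact_range_exp_moments.
have [b b0 mu_exp] := exp_moments_sumabs Xexp.
have dense y (e : R) : L2 X y -> 0 < e ->
    exists2 z, polynomials z & (sqdist X y z < e%:E)%E.
  move=> /L2E[my yoo] e0.
  have [_ /(_ _ e0)[z pz yz]] := l2closure_polynomials b0 mu_exp my yoo.
  by exists z => //; rewrite sqdistE//; exact: measurable_polynomials.
split; first split.
- move=> f pf; apply/L2E; split; first exact: measurable_polynomials.
  exact: polynomials_lty b0 mu_exp _ pf.
- by move=> y yL e e0; apply: dense => //; rewrite exprn_gt0.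
move=> L LM y yL; have my : measurable_fun setT y by case: yL.
have uL p : L p \in unitmx.
  have [_ ME] := LM p.
  by have := moment_mx_unit b0 mu_exp p rhoX; rewrite ME unitmx_mul => /andP[].
pose best p := ereal_inf [set sqdist X y (chaos_sum (L p) c) | c in setT].
have sq0 p c : (0 <= sqdist X y (chaos_sum (L p) c))%E.
  rewrite /sqdist unlock; apply: integral_ge0 => w _; rewrite lee_fin sqr_ge0//.
have best_fin p : best p \is a fin_num.
  rewrite ge0_fin_numE; last by apply/ereal_infP => _ [c _ <-].
  (* Zero coefficients already give the finite value E[y^2]. *)
  apply: (@le_lt_trans _ _ (sqdist X y (chaos_sum (L p) (fun=> 0)))).
    by apply: ereal_inf_lbound; exists (fun=> 0).
  rewrite sqdistE//; last exact: measurable_polynomials (chaos_sum_polynomials _ _).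
  have [_] := (L2E X y).1 yL; congr (_ < _)%E; congr sqnorm.
  by apply/funext => x; rewrite /chaos_sum big1 ?subr0// => i _; rewrite mul0r.
(* Coefficients within 1 / (p + 1) of the infimum take the place of a minimiser. *)
have near_best p : {c | (sqdist X y (chaos_sum (L p) c) < best p + (p.+1%:R^-1)%:E)%E}.
  apply: cid; have p0 : 0 < p.+1%:R^-1 :> R by [].
  have [_ [c _ <-] cp] := lb_ereal_inf_adherent p0 (best_fin p).
  by exists c.
pose c p := sval (near_best p); have cbest p := svalP (near_best p).
have cfin p : sqdist X y (chaos_sum (L p) (c p)) \is a fin_num.
  by rewrite ge0_fin_numE// (lt_trans (cbest p))// lte_add_pinfty ?ltry//
    ltey_eq best_fin.
exists c; apply/fine_cvgP; split; first exact: nearW.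
apply/cvgrPdist_lt => e e0; have e2 : 0 < e / 2 by rewrite divr_gt0.
(* Once p >= [msize q], this q is itself a chaos sum of order p, so [best p] < e / 2; the slack 1 /
   (p + 1) is eventually below the other e / 2. *)
have [_ [q _ <-] yq] := dense _ _ yL e2.
near=> p.
rewrite sub0r normrN ger0_norm ?fine_ge0// -lte_fin fineK//.
apply: lt_trans (cbest p) _.
have -> : e = e / 2 + e / 2 by lra.
rewrite EFinD lteD//; last first.
  by rewrite lte_fin; near: p; exact: (near_infty_natSinv_lt (PosNum e2)).
apply: le_lt_trans yq.
have [|c' ->] := @polynomials_chaos_sum _ _ p (L p) q (uL p).
  by near: p; exists (msize q) => // p /=; exact: leqW.
by apply: ereal_inf_lbound; exists c'.
Unshelve. all: by end_near. Qed.
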